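(* Let $n\ge1$ and let $\theta$ be a real number that is not algebraic of degree $\le n$, with best approximation polynomials $(P_k)_{k\ge1}$ associated to $\theta,n$. Assume that for all sufficiently large $k$ the polynomials $P_k,P_{k+1}$ have no common factor, and that \[\underline\nu:=\liminf_{k\to\infty}-\frac{\log|P_k(\theta)|}{\log H(P_k)}>2n-1.\] Then \[\underline\sigma:=\liminf_{k\to\infty}\frac{\log|P_{k+1}(\theta)|}{\log|P_k(\theta)|}\ge\frac{\underline\nu-n+1}{n},\qquad \overline\tau:=\limsup_{k\to\infty}\frac{\log H(P_{k+1})}{\log H(P_k)}\le\frac{w_n(\theta)}{\widehat w_n(\theta)},\] and if the integer $\ell\ge1$ satisfies \[\ell<\frac{\log\Big(\frac{(\underline\nu-2n+1)(w_n(\theta)-\widehat w_n(\theta))}{n}+1\Big)}{\log(w_n(\theta)/\widehat w_n(\theta))}+1,\] (a quantity which is at most $\frac{\log\big(\frac{(\underline\nu-2n+1)(w_n(\theta)-n)}{n}+1\big)}{\log(w_n(\theta)/n)}+1$), then for every sufficiently large $k$ the polynomials $P_k,P_{k+1},\dots,P_{k+\ell-1}$ are linearly independent.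
   Context: For a nonzero integer polynomial $P$, $H(P)$ denotes its height (maximum absolute value of its coefficients). $w_n(\theta)$ is the supremum of $w$ such that $|P(\theta)|<H(P)^{-w}$ for infinitely many integer polynomials $P$ of degree at most $n$; $\widehat w_n(\theta)$ is the supremum of $\widehat w$ such that for every sufficiently large $X$ there is a nonzero integer polynomial $P$ of degree at most $n$ with $H(P)\le X$ and $0<|P(\theta)|<X^{-\widehat w}$. The best approximation polynomials associated to $\theta,n$ are the (assumed unique up to sign) nonzero integer polynomials $P_k$ of degree at most $n$ with $H(P_1)<H(P_2)<\cdots$ such that $|P_k(\theta)|>0$ is minimal among $|P(\theta)|$ over nonzero integer polynomials $P$ of degree $\le n$ with $H(P)<H(P_{k+1})$; then $|P_1(\theta)|>|P_2(\theta)|>\cdots$.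
   Formalization: The parenthetical ''at most'' is false when w_n(θ) is finite and ŵ_n(θ)>n (e.g. n=2, extremal numbers); it is replaced by ''at least''. When w_n(θ)=∞ the bound on ℓ is undefined (∞/∞) and is read as 2. *)

(* Defs.v *)
From HB Require Import structures.
From mathcomp Require Import all_boot all_order all_algebra.
From mathcomp Require Import all_classical all_reals all_analysis.
Set Implicit Arguments.
Unset Strict Implicit.
Unset Printing Implicit Defensive.
Import Order.TTheory GRing.Theory Num.Theory.
Import numFieldNormedType.Exports.
Local Open Scope classical_set_scope.
Local Open Scope ring_scope.

Definition height (P : {poly int}) : nat := \max_(i < size P) `|(P`_i)%R|%N.

Definition evalZ (R : realType) (P : {poly int}) (theta : R) : R :=
  (map_poly (intr : int -> R) P).[theta].

(* The degree of an algebraic number is that of its minimal polynomial over Q. *)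
Definition algebraic_of_degree (R : realType) (theta : R) (d : nat) : Prop :=
  exists p : {poly rat}, [/\ p \is monic, irreducible_poly p,
    size p = d.+1 & root (map_poly (ratr : rat -> R) p) theta].

(* Both exponents are suprema in \bar R: w_n may be infinite. *)
Definition w_exp (R : realType) (n : nat) (theta : R) : \bar R :=
  ereal_sup [set w%:E | w in [set w : R |
    infinite_set [set P : {poly int} |
      [/\ P != 0, (size P <= n.+1)%N &
          `|evalZ P theta| < (height P)%:R `^ (- w)]]]].

Definition what_exp (R : realType) (n : nat) (theta : R) : \bar R :=
  ereal_sup [set w%:E | w in [set w : R |
    \forall X \near +oo, exists P : {poly int},
      [/\ P != 0, (size P <= n.+1)%N, (height P)%:R <= X &
          0 < `|evalZ P theta| < X `^ (- w)]]].

(* The sequence is indexed by k >= 1; P 0 is unconstrained. *)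
Definition best_approx (R : realType) (n : nat) (theta : R)
    (P : nat -> {poly int}) : Prop :=
  forall k, (0 < k)%N ->
  [/\ P k != 0 /\ (size (P k) <= n.+1)%N,
      (height (P k) < height (P k.+1))%N,
      0 < `|evalZ (P k) theta|,
      (forall Q : {poly int}, Q != 0 -> (size Q <= n.+1)%N ->
        (height Q < height (P k.+1))%N ->
        `|evalZ (P k) theta| <= `|evalZ Q theta|) &
      (forall Q : {poly int}, Q != 0 -> (size Q <= n.+1)%N ->
        (height Q < height (P k.+1))%N ->
        `|evalZ Q theta| = `|evalZ (P k) theta| -> Q = P k \/ Q = - P k)].

Definition nu_inf (R : realType) (theta : R) (P : nat -> {poly int}) : \bar R :=
  limn_einf (fun k : nat =>
    (- (ln `|evalZ (P k) theta| / ln (height (P k))%:R))%:E).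

Definition sigma_inf (R : realType) (theta : R) (P : nat -> {poly int}) :
    \bar R :=
  limn_einf (fun k : nat =>
    (ln `|evalZ (P k.+1) theta| / ln `|evalZ (P k) theta|)%:E).

Definition tau_sup (R : realType) (P : nat -> {poly int}) : \bar R :=
  limn_esup (fun k : nat =>
    (ln (height (P k.+1))%:R / ln (height (P k))%:R : R)%:E).

(* log ((nu - 2n + 1)(w - c)/n + 1) / log (w/c) + 1.  For w = +oo this is
   read as its limit 2 as w tends to +oo with nu and c fixed. *)
Definition ell_bound (R : realType) (n : nat) (nu w c : \bar R) : \bar R :=
  if w == +oo%E then 2%:E else
  (ln ((fine nu - 2 * n%:R + 1) * (fine w - fine c) / n%:R + 1)
     / ln (fine w / fine c) + 1)%:E.

Definition Qlin_indep (l : nat) (p : 'I_l -> {poly int}) : Prop :=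
  forall c : 'I_l -> rat,
    \sum_(i < l) c i *: map_poly (intr : int -> rat) (p i) = 0 ->
    forall i, c i = 0.

(* Main.v *)
(** Write H_k for the height of P_k. The resultant of the coprime polynomials
    P_k and P_(k+1) is a nonzero integer, which gives
      1 << |P_k(theta)| H_k^(n-1) H_(k+1)^n.
    Hence H_(k+1) is large, which bounds sigma from below and shows that
    what_n <= 2n-1 < nu <= w_n; the bound on tau compares the two exponents at
    P_k. If P_j is a combination of the independent P_(j+1), ..., P_(j+m), then
    Cramer's rule bounds its coefficients and gives
      |P_j(theta)| << H_(j+1) ... H_(j+m) |P_(j+1)(theta)|.
    With tau the ratio w_n/what_n, the product of heights is at most about
    H_(j+1)^(1 + tau + ... + tau^(m-1)), whereas |P_(j+1)/P_j|(theta) is at most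
    about H_(j+1)^(- what_n (nu - 2n + 1)/n), so a relation among the l
    polynomials is impossible as soon as
    1 + tau + ... + tau^(l-2) < what_n (nu - 2n + 1)/n. The monotonicity of the
    bound on l in what_n follows from Bernoulli's inequality, used twice. *)

Require Import Defs.
From HB Require Import structures.
From mathcomp Require Import all_boot all_order all_algebra.
From mathcomp Require Import all_classical all_reals all_analysis.
From mathcomp Require Import perm ring lra zify.
Import Order.TTheory GRing.Theory Num.Theory.
Import numFieldNormedType.Exports.
Local Open Scope classical_set_scope.
Local Open Scope ring_scope.

(** * Determinants, heights and the resultant *)

(** Each term of the Leibniz expansion takes one entry from every row and every column, so the
    product bounding it is the same for all N! permutations. *)
Lemma normr_det_le (F : numDomainType) N (M : 'M[F]_N) (h g : 'I_N -> F) :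
  (forall i j, `|M i j| <= h i * g j) ->
  `|\det M| <= N`!%:R * (\prod_i h i * \prod_j g j).
Proof.
move=> hM; rewrite /determinant; apply: le_trans (ler_norm_sum _ _ _) _.
have hs (s : 'S_N) :
    `|(-1) ^+ s * \prod_i M i (s i)| <= \prod_i h i * \prod_j g j.
  rewrite normrM normrX normrN1 expr1n mul1r normr_prod.
  rewrite [X in _ <= _ * X](reindex_inj (@perm_inj _ s)) -big_split /=.
  by apply: ler_prod => i _; rewrite normr_ge0 hM.
apply: le_trans (ler_sum _ (fun s _ => hs s)) _.
by rewrite sumr_const card_Sn mulr_natl.
Qed.

Lemma coef_le_height (P : {poly int}) i : (`|(P`_i)%R|%N <= height P)%N.
Proof.
have [iP|Pi] := ltnP i (size P); last by rewrite nth_default.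
exact: (leq_bigmax (Ordinal iP)).
Qed.

Lemma height_gt0 (P : {poly int}) : P != 0 -> (0 < height P)%N.
Proof.
move=> P0; apply: leq_trans (coef_le_height P (size P).-1).
by rewrite absz_gt0 -lead_coefE lead_coef_eq0.
Qed.

Lemma normr_coef_le_height (R : realType) (P : {poly int}) i :
  `|(P`_i)%:~R| <= (height P)%:R :> R.
Proof.
by rewrite -intr_norm -abszE -pmulrn ler_nat coef_le_height.
Qed.

Lemma height_ge1 (R : realType) (P : {poly int}) :
  P != 0 -> 1 <= (height P)%:R :> R.
Proof. by move=> P0; rewrite ler1n height_gt0. Qed.

Lemma evalZ_coef (R : realType) (P : {poly int}) (theta : R) d :
  (size P <= d)%N -> evalZ P theta = \sum_(i < d) (P`_i)%:~R * theta ^+ i.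
Proof.
move=> sP; rewrite /evalZ (horner_coef_wide (n := d)).
  by apply: eq_bigr => i _; rewrite coef_map_id0.
exact: leq_trans (size_poly _ _) sP.
Qed.

Lemma evalZM (R : realType) (P Q : {poly int}) (theta : R) :
  evalZ (P * Q) theta = evalZ P theta * evalZ Q theta.
Proof. by rewrite /evalZ rmorphM hornerM. Qed.

Lemma evalZXn (R : realType) i (theta : R) : evalZ 'X^i theta = theta ^+ i.
Proof. by rewrite /evalZ map_polyXn hornerXn. Qed.

(* Adding the multiples by theta ^+ j of the columns of the Sylvester matrix to
   its first column turns the latter into the values at theta of the rows; since
   |q(theta)| / H(q) <= |p(theta)| / H(p), all the entries of that column are
   small relatively to the height of their row. *)
Lemma resultant_lower_bound (R : realType) (n : nat) (theta : R) :
  (0 < n)%N ->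
  exists2 K : R, 0 < K & forall p q : {poly int},
    (size p <= n.+1)%N -> (size q <= n.+1)%N -> (1 < size p)%N ->
    coprimep p q -> (height p <= height q)%N ->
    `|evalZ q theta| <= `|evalZ p theta| ->
    1 <= K * (`|evalZ p theta| * (height p)%:R ^+ n.-1 * (height q)%:R ^+ n).
Proof.
move=> n0; pose B := 1 + `|theta|.
have B1 : 1 <= B by rewrite lerDl.
exists ((2 * n)`!%:R * B ^+ (2 * n)).
  by rewrite mulr_gt0 ?ltr0n ?fact_gt0// exprn_gt0// (lt_le_trans ltr01).
move=> p q sp sq p1 cpq hpq epq.
have p0 : p != 0 by rewrite -size_poly_gt0 ltnW.
have q0 : q != 0.
  apply: contraTneq cpq => ->; rewrite coprimep0 -size_poly_eq1.
  by rewrite neq_ltn p1 orbT.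
pose dS := ((size q).-1 + (size p).-1)%N.
have dS0 : (0 < dS)%N by rewrite addn_gt0 orbC -subn1 subn_gt0 p1.
have dSn : (dS <= 2 * n)%N.
  by rewrite mul2n -addnn leq_add// -ltnS prednK// size_poly_gt0.
pose j0 := Ordinal dS0.
pose V : 'M[R]_dS :=
  \matrix_(i, j) (if j == j0 then theta ^+ i else (i == j)%:R).
have V1 : \det V = 1.
  rewrite det_trig.
    rewrite big1// => i _; rewrite mxE.
    by case: eqP => [->|]; rewrite ?eqxx ?expr0.
  apply/is_trig_mxP => i j ij; rewrite mxE; case: eqP => [j00|_].
    by rewrite j00 in ij.
  by rewrite -val_eqE ltn_eqF.
pose rowp (i : 'I_dS) : {poly int} := match fintype.split i with
  | inl k => 'X^k * p | inr k => 'X^k * q end.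
have [S S0 SE] : exists2 S : 'M[int]_dS, \det S != 0 &
    forall i j, S i j = (rowp i)`_j.
  exists (Sylvester_mx p q) => [|i j].
    by rewrite [X in X != 0]/(resultant p q) resultant_eq0 (eqP cpq).
  rewrite Sylvester_mxE /rowp.
  by case: (fintype.split i) => k; rewrite coefXnM; case: leqP.
have srow i : (size (rowp i) <= dS)%N.
  rewrite /rowp; case: (fintype.split i) => k.
    apply: leq_trans (size_polyMleq _ _) _; rewrite size_polyXn addSn /=.
    by rewrite -(prednK (ltnW p1)) addnS /dS -addSn leq_add2r.
  apply: leq_trans (size_polyMleq _ _) _; rewrite size_polyXn addSn /=.
  rewrite -[size q]prednK ?size_poly_gt0// addnS /dS -addSn.
  by rewrite addnC leq_add2l.
pose M := map_mx (intr : int -> R) S *m V.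
have ME i j : M i j = if j == j0 then evalZ (rowp i) theta else (S i j)%:~R.
  rewrite mxE; case: eqP => [->|/eqP jj0].
    rewrite (evalZ_coef _ _ _ _ (srow i)); apply: eq_bigr => k _.
    by rewrite !mxE eqxx SE.
  rewrite (bigD1 j)//= !mxE (negPf jj0) eqxx mulr1 big1 ?addr0// => k kj.
  by rewrite !mxE (negPf jj0) (negPf kj) mulr0.
pose Hp : R := (height p)%:R; pose Hq : R := (height q)%:R.
have Hp1 : 1 <= Hp by exact: height_ge1.
have Hq1 : 1 <= Hq by exact: height_ge1.
have Hp0 : 0 < Hp by exact: lt_le_trans Hp1.
have Hq0 : 0 < Hq by exact: lt_le_trans Hq1.
have HpHq : Hp <= Hq by rewrite ler_nat.
pose h (i : 'I_dS) := match fintype.split i with inl _ => Hp | inr _ => Hq end.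
pose g (j : 'I_dS) := if j == j0 then B ^+ dS * (`|evalZ p theta| / Hp) else 1.
have Mhg i j : `|M i j| <= h i * g j.
  rewrite ME /h /g; case: eqP => _; last first.
    rewrite mulr1 SE /rowp; case: (fintype.split i) => k; rewrite coefXnM;
    by case: ifP => _; rewrite ?mulr0z ?normr0 ?normr_coef_le_height// ltW.
  have Bk k : (k <= dS)%N -> `|theta| ^+ k <= B ^+ dS.
    move=> kd; apply: (@le_trans _ _ (B ^+ k)).
      by rewrite lerXn2r ?nnegrE ?lerDr// (le_trans _ B1).
    by rewrite ler_weXn2l.
  rewrite /rowp; case: (splitP i) => k ik; rewrite evalZM evalZXn normrM normrX.
    rewrite mulrCA [Hp * _]mulrC divfK ?gt_eqF// ler_wpM2r// Bk//.
    by rewrite (leq_trans (ltnW (ltn_ord k)))// leq_addr.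
  rewrite mulrCA; apply: ler_pM => //.
    by rewrite Bk// (leq_trans (ltnW (ltn_ord k)))// leq_addl.
  apply: le_trans epq _; rewrite mulrCA ler_peMr// ler_pdivlMr// mul1r//.
have prodh : \prod_i h i = Hp ^+ (size q).-1 * Hq ^+ (size p).-1.
  rewrite /h /= (big_split_ord _ _) /=; congr (_ * _).
    under eq_bigr => i _ do rewrite (unsplitK (inl i)).
    by rewrite prodr_const card_ord.
  under eq_bigr => i _ do rewrite (unsplitK (inr i)).
  by rewrite prodr_const card_ord.
have prodg : \prod_j g j = B ^+ dS * (`|evalZ p theta| / Hp).
  rewrite (bigD1 j0)//= big1 ?mulr1 /g ?eqxx// => j /negPf jj0.
  by rewrite jj0.
have := normr_det_le _ _ M h g Mhg.
rewrite det_mulmx V1 mulr1 det_map_mx prodh prodg => hdet.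
have {}hdet := le_trans _ hdet.
have /hdet : 1 <= `|(\det S)%:~R : R|.
  by rewrite -intr_norm -[1]/(1%:~R) ler_int -gtz0_ge1 normr_gt0.
move/le_trans; apply.
(* The weight of the first column carries a factor [1 / Hp]; this is what lowers the exponent of
   [Hp] from [n] to [n.-1]. *)
have -> : Hp ^+ (size q).-1 * Hq ^+ (size p).-1 *
    (B ^+ dS * (`|evalZ p theta| / Hp)) =
    B ^+ dS * (`|evalZ p theta| * (Hp ^+ (size q).-1 / Hp) * Hq ^+ (size p).-1).
  by ring.
have B0 : 0 <= B by exact: le_trans B1.
have [Hp_ge0 Hq_ge0] := (ltW Hp0, ltW Hq0).
rewrite -[X in _ <= X]mulrA; apply: ler_pM => //.
- by rewrite !mulr_ge0 ?invr_ge0 ?exprn_ge0.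
- by rewrite ler_nat leq_fact.
apply: ler_pM.
- exact: exprn_ge0.
- by rewrite !mulr_ge0 ?invr_ge0 ?exprn_ge0.
- by rewrite ler_weXn2l.
apply: ler_pM.
- by rewrite !mulr_ge0 ?invr_ge0 ?exprn_ge0.
- exact: exprn_ge0.
- rewrite ler_wpM2l// ler_pdivrMr// -exprSr prednK// ler_weXn2l//.
  by rewrite -ltnS prednK// size_poly_gt0.
- by rewrite ler_weXn2l// -ltnS prednK// size_poly_gt0.
Qed.

(** * Cramer's rule and linear relations *)

(** By Cramer's rule [b 0 j * \det M] is the determinant of [M] with row [j] replaced by [u]. As [u]
    obeys the bound of every row, so does the new matrix; and [\det M], a nonzero integer, has
    absolute value at least 1. *)
Lemma cramer_normr_le m (M : 'M[int]_m) (b : 'rV[rat]_m) (u : 'rV[int]_m)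
    (h : 'I_m -> rat) :
  \det M != 0 -> map_mx intr u = b *m map_mx intr M ->
  (forall i j, `|(M i j)%:~R| <= h i) -> (forall i j, `|(u 0 j)%:~R| <= h i) ->
  forall j, `|b 0 j| <= m`!%:R * \prod_i h i.
Proof.
move=> M0 uE hM hu j.
pose Mj : 'M[int]_m := \matrix_(i, k) (if i == j then u 0 k else M i k).
have detMj : b 0 j * (\det M)%:~R = (\det Mj)%:~R.
  transitivity ((map_mx intr u *m \adj (map_mx intr M)) 0 j : rat).
    by rewrite uE -mulmxA mul_mx_adj mul_mx_scalar mxE det_map_mx mulrC.
  rewrite (expand_det_row _ j) rmorph_sum mxE; apply: eq_bigr => k _.
  rewrite !mxE eqxx rmorphM /=; congr (_ * _).
  rewrite -cofactor_map_mx; congr (_ * \det _).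
  by apply/matrixP => i l; rewrite !mxE eq_sym (negPf (neq_lift _ _)).
have : `|(\det Mj)%:~R : rat| <= m`!%:R * \prod_i h i.
  have /normr_det_le : forall i k,
      `|map_mx (intr : int -> rat) Mj i k| <= h i * (fun=> 1) k.
    by move=> i k; rewrite mulr1 !mxE; case: ifP.
  by rewrite det_map_mx big1_eq mulr1.
apply: le_trans; rewrite -detMj normrM ler_peMr// -intr_norm.
by rewrite -[1]/(1%:~R) ler_int -gtz0_ge1 normr_gt0.
Qed.

Lemma Qlin_indep_row_free m N (q : 'I_m -> {poly int}) :
  (forall i, (size (q i) <= N)%N) -> Qlin_indep q ->
  row_free (\matrix_(i < m, j < N) ((q i)`_j)%:~R : 'M[rat]_(m, N)).
Proof.
move=> sq qfree; rewrite -kermx_eq0; apply/eqP/row_matrixP => i0.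
rewrite row0; set A := \matrix_(_, _) _.
have /sub_kermxP := row_sub i0 (kermx A); move: (row _ _) => v vA.
apply/rowP => i; rewrite mxE; move: i; apply: qfree.
apply/polyP => j; rewrite coef_sum coef0.
have [jN|Nj] := ltnP j N; last first.
  rewrite big1// => i _; rewrite coefZ coef_map_id0//= nth_default ?mulr0//.
  exact: leq_trans (sq i) Nj.
move/rowP/(_ (Ordinal jN)): vA; rewrite !mxE => vA; rewrite -[RHS]vA.
by apply: eq_bigr => i _; rewrite coefZ coef_map_id0// !mxE.
Qed.

Lemma dependent_combination m (p : 'I_m.+1 -> {poly int}) :
  Qlin_indep (fun i => p (lift ord0 i)) -> ~ Qlin_indep p ->
  exists b : 'I_m -> rat, map_poly (intr : int -> rat) (p ord0) =
    \sum_(i < m) b i *: map_poly (intr : int -> rat) (p (lift ord0 i)).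
Proof.
move=> qfree /existsNP[c /not_implyP[]].
rewrite big_ord_recl => csum /existsNP cN0.
have c0 : c ord0 != 0.
  apply/eqP => c00; case: cN0 => i; apply; move: csum.
  rewrite c00 scale0r add0r => /qfree c1.
  by case: (unliftP ord0 i) => [j ->|->].
exists (fun i => - (c (lift ord0 i) / c ord0)).
apply: (scalerI c0); move/eqP: csum; rewrite addr_eq0 => /eqP->.
rewrite scaler_sumr -sumrN; apply: eq_bigr => i _.
by rewrite scalerA mulrN mulrCA divff// mulr1 scaleNr.
Qed.

(** The first polynomial is a combination of the other [m], which are independent. Cramer's rule on
    a nonzero minor of their coefficient matrix bounds each coefficient by m! times the product of
    heights; evaluation at [theta] then gives [m] terms, each multiplied by a value of size at most
    [e]. *)
Lemma dependent_value_le (R : realType) (theta e : R) m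
    (p : 'I_m.+1 -> {poly int}) :
  (forall i, height (p ord0) <= height (p (lift ord0 i)))%N ->
  (forall i, `|evalZ (p (lift ord0 i)) theta| <= e) ->
  Qlin_indep (fun i => p (lift ord0 i)) -> ~ Qlin_indep p ->
  `|evalZ (p ord0) theta| <=
    (m * m`! * \prod_(i < m) height (p (lift ord0 i)))%:R * e.
Proof.
move=> hp he qfree pdep.
have [b pE] := dependent_combination _ _ qfree pdep.
pose N := (\max_i size (p i))%N.
have sp i : (size (p i) <= N)%N by exact: leq_bigmax.
pose A : 'M[int]_(m, N) := \matrix_(i, j) (p (lift ord0 i))`_j.
pose u : 'rV[int]_N := \row_j (p ord0)`_j.
have rA : row_full (map_mx (intr : int -> rat) A)^T.
  rewrite /row_full mxrank_tr.
  have := Qlin_indep_row_free _ N _ (fun i => sp (lift ord0 i)) qfree.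
  rewrite /row_free; congr (\rank _ == _).
  by apply/matrixP => i j; rewrite !mxE.
(* [f] selects [m] columns of [A] whose minor is nonzero. *)
pose f := fullrankfun rA.
have b_le i : `|b i| <= m`!%:R * \prod_i (height (p (lift ord0 i)))%:R.
  have <- : (\row_i b i) 0 i = b i by rewrite mxE.
  apply: (cramer_normr_le _ (colsub f A) _ (colsub f u)).
  - have := fullrowsub_unit rA; rewrite -trmx_mxsub unitmx_tr -map_mxsub.
    rewrite unitmxE.
    by rewrite det_map_mx unitfE intr_eq0.
  - apply/rowP => j; rewrite !mxE; have := congr1 (coefp (f j)) pE.
    rewrite /= coef_map_id0// coef_sum => ->; apply: eq_bigr => k _.
    by rewrite !mxE coefZ coef_map_id0.
  - move=> k j; rewrite !mxE -intr_norm -abszE -pmulrn ler_nat.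
    exact: coef_le_height.
  - move=> k j; rewrite !mxE -intr_norm -abszE -pmulrn ler_nat.
    exact: leq_trans (coef_le_height _ _) (hp k).
have -> : evalZ (p ord0) theta =
    \sum_(i < m) ratr (b i) * evalZ (p (lift ord0 i)) theta.
  have evE (r : {poly int}) : evalZ r theta =
      (map_poly (ratr : rat -> R) (map_poly intr r)).[theta].
    rewrite /evalZ -map_poly_comp; congr (_.[_]); apply: eq_map_poly => z /=.
    by rewrite ratr_int.
  rewrite evE pE rmorph_sum horner_sum; apply: eq_bigr => i _.
  by rewrite /= map_polyZ hornerZ evE.
apply: le_trans (ler_norm_sum _ _ _) _.
rewrite -mulnA natrM -mulrA -[m in m%:R]card_ord mulr_natl -sumr_const.
apply: ler_sum => i _; rewrite normrM; apply: ler_pM => //.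
rewrite -ratr_norm natrM natr_prod.
have := b_le i; rewrite -(ler_rat R) => /le_trans; apply.
rewrite rmorphM rmorph_nat rmorph_prod /=.
by under eq_bigr do rewrite rmorph_nat.
Qed.

(** Polynomials are dropped from the front until the remaining ones are independent: the last one
    dropped, [P j], is a combination of the [m] that follow. Monotonicity of heights and values
    makes [dependent_value_le] apply with [e] the value of [P j.+1]. *)
Lemma dependent_segment (R : realType) (theta : R) (P : nat -> {poly int}) k l :
  (forall i, (k <= i)%N -> (height (P i) <= height (P i.+1))%N) ->
  (forall i, (k <= i)%N ->
    `|evalZ (P i.+1) theta| <= `|evalZ (P i) theta|) ->
  ~ Qlin_indep (fun i : 'I_l => P (k + i)%N) ->
  exists j m, [/\ (k <= j)%N, (m < l)%N &
    `|evalZ (P j) theta| <=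
      (m * m`! * \prod_(i < m) height (P (j.+1 + i)))%:R *
      `|evalZ (P j.+1) theta|].
Proof.
elim: l k => [|l IH] k hP eP dep; first by case: dep => c _ [].
have [free|dep'] := pselect (Qlin_indep (fun i : 'I_l => P (k.+1 + i)%N)).
  exists k, l; split=> //; pose p (i : 'I_l.+1) := P (k + i)%N.
  have pE i : p (lift ord0 i) = P (k.+1 + i)%N.
    by rewrite /p /= /bump /= add1n addnS addSn.
  have := @dependent_value_le R theta `|evalZ (P k.+1) theta| l p.
  have -> : p ord0 = P k by rewrite /p addn0.
  rewrite (eq_bigr _ (fun i _ => congr1 height (pE i))); apply => //.
  - move=> i; rewrite pE.
    elim: (nat_of_ord i) => [|d IHd]; first by rewrite addn0 hP.
    by rewrite addnS (leq_trans IHd)// hP// ltnW// ltnS leq_addr.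
  - move=> i; rewrite pE.
    elim: (nat_of_ord i) => [|d IHd]; first by rewrite addn0.
    by rewrite addnS (le_trans _ IHd)// eP// ltnW// ltnS leq_addr.
  - by under eq_fun do rewrite pE.
have [||j [m [kj ml jm]]] := IH _ _ _ dep'.
- by move=> i /ltnW; exact: hP.
- by move=> i /ltnW; exact: eP.
by exists j, m; split=> //; [exact: ltnW|exact: ltnW].
Qed.

(** * Minimal polynomials and Dirichlet's theorem *)

(** A nonzero polynomial of least size vanishing at [theta], made monic, is irreducible: in a
    factorization one factor vanishes at [theta], hence has full size by minimality. *)
Lemma irreducible_factor_root (R : realType) (theta : R) (p : {poly rat}) :
  p != 0 -> root (map_poly (ratr : rat -> R) p) theta ->
  exists q : {poly rat}, [/\ q \is monic, irreducible_poly q,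
    (size q <= size p)%N & root (map_poly (ratr : rat -> R) q) theta].
Proof.
move=> p0 rp; pose Q k := `[< exists q : {poly rat}, [/\ q != 0, size q = k &
  root (map_poly (ratr : rat -> R) q) theta] >].
have exQ : exists k, Q k by exists (size p); apply/asboolP; exists p.
case: (ex_minnP exQ) => k /asboolP[q [q0 sq rq]] kmin.
have qmin (r : {poly rat}) : r != 0 ->
    root (map_poly (ratr : rat -> R) r) theta -> (size q <= size r)%N.
  by move=> r0 rr; rewrite sq kmin//; apply/asboolP; exists r.
have lq0 : (lead_coef q)^-1 != 0 by rewrite invr_eq0 lead_coef_eq0.
exists ((lead_coef q)^-1 *: q); split.
- by rewrite monicE lead_coefZ mulVf// lead_coef_eq0.
- split.
    rewrite size_scale// ltnNge; apply/negP => /size1_polyC qC.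
    move: rq q0; rewrite qC map_polyC rootC /= fmorph_eq0 polyC_eq0.
    by move=> ->.
  move=> r r1; rewrite dvdpZr// => rdq.
  rewrite (eqp_trans _ (_ : q %= _))// ?(eqp_sym q) ?eqp_scale//.
  have r0 : r != 0 by apply: contraNneq q0 => r0; rewrite -dvd0p -r0.
  have := rdq; rewrite dvdp_eq => /eqP qE.
  have d0 : q %/ r != 0 by apply: contraNneq q0 => d0; rewrite qE d0 mul0r.
  move: rq; rewrite {1}qE rmorphM rootM => /orP[/(qmin _ d0)|/(qmin _ r0) qr].
    rewrite {1}qE size_mul// -[size r]prednK ?size_poly_gt0// addnS /=.
    rewrite -[leqRHS]addn0 leq_add2l leqn0 -eqSS prednK ?size_poly_gt0//.
    by rewrite (negPf r1).
  by rewrite -(dvdp_size_eqp rdq) eqn_leq qr dvdp_leq.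
- by rewrite size_scale// qmin.
- by rewrite map_polyZ rootZ// fmorph_eq0.
Qed.

Lemma evalZ_neq0 (R : realType) n (theta : R) (P : {poly int}) :
  (forall d, (d <= n)%N -> ~ algebraic_of_degree theta d) ->
  P != 0 -> (size P <= n.+1)%N -> evalZ P theta != 0.
Proof.
move=> htheta P0 sP; apply/negP => rP.
pose p : {poly rat} := map_poly intr P.
have szp : size p = size P.
  by rewrite size_map_poly_id0// intr_eq0 lead_coef_eq0.
have p0 : p != 0 by rewrite -size_poly_eq0 szp size_poly_eq0.
have [|q [qmon qirr sq rq]] := @irreducible_factor_root R theta p p0.
  rewrite /root /p -map_poly_comp; move: rP; rewrite /evalZ.
  by under [in X in _ -> X]eq_map_poly do rewrite /= ratr_int.
have q1 : (0 < size q)%N by case: qirr => /ltnW.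
apply: (htheta (size q).-1); last by exists q; rewrite prednK.
by rewrite -ltnS prednK// (leq_trans sq)// szp.
Qed.

(** Pigeonhole on the values [v a] of the polynomials with coefficients in {0, ..., H}: the
    difference of two of them falling in the same box is the required polynomial. *)
Lemma dirichlet_polynomial (R : realType) (theta : R) n H :
  (0 < n)%N -> (0 < H)%N ->
  exists P : {poly int}, [/\ P != 0, (size P <= n.+1)%N, (height P <= H)%N &
    `|evalZ P theta| < 2 * (\sum_(i < n.+1) `|theta| ^+ i) / H%:R ^+ n].
Proof.
move=> n0 H0; set T := \sum_(_ < _) _.
have T1 : 1 <= T.
  by rewrite /T big_ord_recl expr0 lerDl sumr_ge0.
pose N := (H ^ n.+1)%N.
have N0 : (0 < N)%N by rewrite expn_gt0 H0.
have HR : (0 : R) < H%:R by rewrite ltr0n.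
pose v (a : {ffun 'I_n.+1 -> 'I_H.+1}) : R := \sum_i (a i)%:R * theta ^+ i.
have vT a : `|v a| <= H%:R * T.
  rewrite /v /T mulr_sumr; apply: le_trans (ler_norm_sum _ _ _) _.
  apply: ler_sum => i _; rewrite normrM normrX ler_wpM2r//.
  by rewrite normr_nat ler_nat -ltnS.
have HT : 0 < H%:R * T by rewrite mulr_gt0// (lt_le_trans _ T1).
(* [x] rescales the interval [-HT, HT] to [0, N]. The right endpoint is allowed, so the integer
   parts take up to N + 1 values. *)
pose x a := (v a + H%:R * T) / (2 * (H%:R * T)) * N%:R.
have x0 a : 0 <= x a.
  have := vT a; rewrite ler_norml => /andP[va _].
  by apply: mulr_ge0 => //; apply: divr_ge0; lra.
have xN a : (Num.truncn (x a) < N.+1)%N.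
  rewrite ltnS truncn_le_nat -natr1 ltr_pwDr//.
  have := vT a; rewrite ler_norml => /andP[_ va].
  by rewrite /x ler_piMl// ler_pdivrMr ?mulr_gt0//; lra.
have /injectivePn : ~~ injectiveb (fun a => Ordinal (xN a)).
  apply/negP => /injectiveP /leq_card; rewrite card_ffun !card_ord leqNgt.
  move/negP; apply; have := expn_gt0 H n; rewrite H0 /= => Hn0.
  (* Since n > 0, (H+1)^(n+1) >= (H+1)(H^n + 1) > H^(n+1) + 1, so there are more tuples than
     boxes. *)
  have : (H ^ n < H.+1 ^ n)%N by rewrite ltn_exp2r.
  by rewrite /N !expnS; move: (H ^ n)%N (H.+1 ^ n)%N Hn0 => c d; nia.
move=> [a [b ab /(congr1 val)/= xab]].
have vab : `|v a - v b| < 2 * T / H%:R ^+ n.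
  have -> : v a - v b = (x a - x b) * (2 * T / H%:R ^+ n).
    rewrite /x natrX exprS; field.
    by rewrite !gt_eqF ?exprn_gt0// (lt_le_trans _ T1).
  have TH0 : 0 < 2 * T / H%:R ^+ n.
    by rewrite divr_gt0 ?exprn_gt0// mulr_gt0// (lt_le_trans _ T1).
  rewrite normrM (gtr0_norm TH0) gtr_pMl//.
  have /andP[a1 a2] := truncn_itv (x0 a).
  have /andP[b1 b2] := truncn_itv (x0 b).
  move: a1 a2; rewrite xab => a1 a2; move: b2 a2; rewrite -natr1 => b2 a2.
  by rewrite ltr_norml; apply/andP; split; lra.
pose P := \poly_(i < n.+1) ((a (inord i))%:Z - (b (inord i))%:Z).
have PE (i : 'I_n.+1) : P`_i = (a i)%:Z - (b i)%:Z.
  by rewrite coef_poly ltn_ord inord_val.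
have sP : (size P <= n.+1)%N by exact: size_poly.
exists P; split => //.
- apply: contra_neq ab => P0; apply/ffunP => i; apply/val_inj/eqP.
  by have := PE i; rewrite P0 coef0 => /esym/eqP; rewrite subr_eq0 eqz_nat.
- apply/bigmax_leqP => i _; have iP := leq_trans (ltn_ord i) sP.
  have := PE (Ordinal iP); rewrite /= => ->.
  move: (ltn_ord (a (Ordinal iP))) (ltn_ord (b (Ordinal iP))).
  by move: (val (a _)) (val (b _)) => s t; lia.
rewrite (evalZ_coef _ _ _ _ sP); rewrite (_ : \sum_i _ = v a - v b)//.
rewrite /v -sumrB; apply: eq_bigr => i _.
by rewrite PE rmorphB /= -mulrBl.
Qed.

Lemma what_exp_ge (R : realType) n (theta : R) :
  (0 < n)%N -> (forall d, (d <= n)%N -> ~ algebraic_of_degree theta d) ->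
  (n%:R%:E <= what_exp n theta)%E.
Proof.
move=> n0 htheta; apply/lee_subgt0Pr => e e0.
apply: ereal_sup_ubound; exists (n%:R - e) => //=.
set T := \sum_(i < n.+1) `|theta| ^+ i.
(* The factor [2 ^+ n] pays for replacing [Num.truncn X] by its lower bound [X / 2]. *)
pose K := 2 * T * 2 ^+ n.
have T1 : 1 <= T.
  by rewrite /T big_ord_recl expr0 lerDl sumr_ge0.
have K0 : 0 < K by rewrite !mulr_gt0// (lt_le_trans _ T1).
near=> X.
have X1 : 1 <= X by near: X; exact: nbhs_pinfty_ge.
have X0 : 0 < X by exact: lt_le_trans X1.
have XK : K <= X `^ e.
  have KX : K `^ e^-1 <= X by near: X; exact: nbhs_pinfty_ge.
  have -> : K = (K `^ e^-1) `^ e.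
    by rewrite -powRrM mulVf ?powRr1 ?ltW// gt_eqF.
  by apply: ge0_ler_powR; rewrite ?nnegrE ?powR_ge0 ?ltW.
have H0 : (0 < Num.truncn X)%N by rewrite truncn_gt0.
have HX : X / 2 <= (Num.truncn X)%:R.
  have := truncnS_gt X; rewrite -natr1.
  have : 1 <= (Num.truncn X)%:R :> R by rewrite ler1n.
  by lra.
have [P [P0 sP hP eP]] := dirichlet_polynomial R theta n (Num.truncn X) n0 H0.
exists P; split => //.
  by apply: (@le_trans _ _ (Num.truncn X)%:R); rewrite ?ler_nat// truncn_le ltW.
rewrite normr_gt0 (evalZ_neq0 _ _ _ _ htheta)//=.
apply: (lt_le_trans eP).
rewrite opprB powRD ?(gt_eqF X0) ?implybT// powRN powR_mulrn ?(ltW X0)//.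
rewrite ler_pdivrMr ?exprn_gt0 ?ltr0n//.
apply: (@le_trans _ _ (X `^ e / X ^+ n * (X / 2) ^+ n)).
  have -> : X `^ e / X ^+ n * (X / 2) ^+ n = X `^ e / 2 ^+ n.
    by rewrite expr_div_n; field; rewrite !gt_eqF ?exprn_gt0.
  by rewrite ler_pdivlMr ?exprn_gt0.
apply: ler_wpM2l.
  by rewrite divr_ge0 ?powR_ge0 ?exprn_ge0// ltW.
by apply: lerXn2r => //; rewrite nnegrE ?divr_ge0// ltW.
Unshelve. all: by end_near.
Qed.

(** * Lower and upper limits, and concavity inequalities *)

Lemma near_gt_limn_einf (R : realType) (u : (\bar R)^nat) (x : \bar R) :
  (x < limn_einf u)%E -> \forall k \near \oo, (x < u k)%E.
Proof.
rewrite limn_einf_lim (cvg_lim _ (@cvg_einfs_sup _ u))//.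
move=> /ereal_sup_gt[_ [N _ <-]] xN; exists N => // k /= Nk.
by apply: (lt_le_trans xN); apply: ereal_inf_lbound; exists k.
Qed.

Lemma limn_einf_ge_near (R : realType) (u : (\bar R)^nat) (x : \bar R) :
  (\forall k \near \oo, (x <= u k)%E) -> (x <= limn_einf u)%E.
Proof.
move=> [N _ xu]; rewrite limn_einf_lim (cvg_lim _ (@cvg_einfs_sup _ u))//.
apply: le_ereal_sup_tmp; exists (einfs u N); first by exists N.
by apply: le_ereal_inf_tmp => _ [k /= Nk <-]; exact: xu.
Qed.

Lemma limn_esup_le_near (R : realType) (u : (\bar R)^nat) (x : \bar R) :
  (\forall k \near \oo, (u k <= x)%E) -> (limn_esup u <= x)%E.
Proof.
move=> ux; rewrite -leeN2 -limn_einfN; apply: limn_einf_ge_near.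
by apply: filterS ux => k; rewrite /= leeN2.
Qed.

(** Bernoulli's inequality. The right side [s] is the mean of [y] and 1 with weights [t] and
    [1 - t]. The tangent to [ln] at [s] lies above [ln] at both points, and in the weighted average
    its linear part cancels. *)
Lemma powR_le_affine (R : realType) (y t : R) :
  0 < y -> 0 <= t <= 1 -> y `^ t <= 1 + t * (y - 1).
Proof.
move=> y0 /andP[t0 t1]; have s0 : 0 < 1 + t * (y - 1) by nra.
set s := 1 + _ in s0 *; rewrite -ler_ln ?posrE ?powR_gt0// ln_powR.
have ln_le (z : R) : 0 < z -> ln z - ln s <= z / s - 1.
  move=> z0; rewrite -ln_div ?posrE// -[X in ln X](subrK 1) addrC le_ln1Dx//.
  by rewrite ltrBrDl subrr divr_gt0.
have ly := ln_le _ y0; have l1 := ln_le 1 ltr01; rewrite ln1 in l1.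
have sE : t * (y / s) + (1 - t) * (1 / s) = 1.
  by rewrite /s; field; rewrite gt_eqF.
have : t * (ln y - ln s) + (1 - t) * (0 - ln s) <=
    t * (y / s - 1) + (1 - t) * (1 / s - 1).
  by apply: lerD; apply: ler_wpM2l; rewrite ?subr_ge0.
by move: sE; lra.
Qed.

Lemma ln_prod_natr (R : realType) m (f : nat -> nat) :
  (forall i, (0 < f i)%N) ->
  ln (\prod_(i < m) f i)%:R = \sum_(i < m) ln (f i)%:R :> R.
Proof.
move=> f0; elim: m => [|m IH]; first by rewrite !big_ord0 ln1.
by rewrite !big_ord_recr /= natrM lnM ?IH// posrE ltr0n// prodn_gt0.
Qed.

(** With [t] the quotient of [ln (w / c)] by [ln (w / m)], one has (m/w)^t = c/w, and Bernoulli at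
    m/w gives t(w - m) <= w - c. Bernoulli at a(w - m) + 1 then gives (a(w - m) + 1)^t <= a(w - c) +
    1, whose logarithm is the claim. *)
Lemma ln_ratio_ge (R : realType) (a m c w : R) :
  0 <= a -> 0 < m -> m <= c -> c < w ->
  ln (a * (w - m) + 1) / ln (w / m) <= ln (a * (w - c) + 1) / ln (w / c).
Proof.
move=> a0 m0 mc cw.
have c0 : 0 < c by exact: lt_le_trans mc.
have w0 : 0 < w by exact: lt_trans cw.
have lc : 0 < ln (w / c) by rewrite ln_gt0// ltr_pdivlMr// mul1r.
have lm : 0 < ln (w / m).
  by rewrite ln_gt0// ltr_pdivlMr// mul1r (le_lt_trans mc).
pose t := ln (w / c) / ln (w / m).
have t01 : 0 <= t <= 1.
  rewrite divr_ge0 ?(ltW lc) ?(ltW lm)//= ler_pdivrMr// mul1r.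
  by rewrite ler_ln ?posrE ?divr_gt0// ler_pM2l// lef_pV2.
have cwE : (m / w) `^ t = c / w.
  rewrite /powR gt_eqF ?divr_gt0//.
  have -> : ln (m / w) = - ln (w / m)
    by rewrite -lnV ?posrE ?divr_gt0// invf_div.
  rewrite mulrN /t divfK ?gt_eqF// -lnV ?posrE ?divr_gt0// invf_div.
  by rewrite lnK// posrE divr_gt0.
have := powR_le_affine R (m / w) t (divr_gt0 m0 w0) t01; rewrite cwE => h1.
have {}h1 : t * (w - m) <= w - c.
  have : c / w * w <= (1 + t * (m / w - 1)) * w by rewrite ler_pM2r.
  rewrite divfK ?gt_eqF//.
  have -> : (1 + t * (m / w - 1)) * w = w + t * (m - w).
    by field; rewrite gt_eqF.
  by lra.
have g0 : 0 < a * (w - m) + 1.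
  by rewrite ltr_wpDl// mulr_ge0// subr_ge0 (le_trans mc)// ltW.
have h2 := powR_le_affine R _ t g0 t01.
have {}h2 : (a * (w - m) + 1) `^ t <= a * (w - c) + 1.
  by apply: (le_trans h2); rewrite addrK mulrCA addrC lerD2r ler_wpM2l.
rewrite ler_pdivlMr// mulrAC -mulrA -/t mulrC -ln_powR.
rewrite ler_ln// posrE ?powR_gt0//.
by rewrite ltr_wpDl// mulr_ge0// subr_ge0 ltW.
Qed.

(** * Best approximations on the logarithmic scale *)

Definition log_height (R : realType) (P : nat -> {poly int}) k : R :=
  ln (height (P k))%:R.

(** The sign makes this quantity positive once the value at [theta] is below 1; all estimates become
    linear in it and in [log_height]. *)
Definition log_value (R : realType) (theta : R) (P : nat -> {poly int}) k : R :=
  - ln `|evalZ (P k) theta|.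

Section BestApprox.
Variables (R : realType) (n : nat) (theta : R) (P : nat -> {poly int}).
Hypothesis hP : best_approx n theta P.

Local Notation L := (log_height R P).
Local Notation E := (log_value R theta P).

Lemma best_approx_height_ge k : (0 < k)%N -> (k <= height (P k))%N.
Proof.
elim: k => // -[_ _|k IH _].
  by have [[P0 _] _ _ _ _] := hP _ (ltn0Sn 0); exact: height_gt0.
by have [_ hlt _ _ _] := hP _ (ltn0Sn k); exact: leq_ltn_trans (IH _) hlt.
Qed.

Lemma best_approx_ln_height_near (A : R) : \forall k \near \oo, A <= L k.
Proof.
near=> k; have k0 : (0 < k)%N by near: k; exact: nbhs_infty_gt.
have Ak : expR A <= k%:R by near: k; exact: nbhs_infty_ger.
have hk := best_approx_height_ge _ k0.
rewrite -[A]expRK ler_ln ?posrE ?expR_gt0 ?ltr0n ?(leq_trans k0)//.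
by apply: (le_trans Ak); rewrite ler_nat.
Unshelve. all: by end_near.
Qed.

Lemma best_approx_height_le k :
  (0 < k)%N -> (height (P k) <= height (P k.+1))%N.
Proof. by move=> /(hP _)[_ /ltnW]. Qed.

Lemma best_approx_evalZ_le k :
  (0 < k)%N -> `|evalZ (P k.+1) theta| <= `|evalZ (P k) theta|.
Proof.
move=> k0; have [[P0 sP] hlt _ _ _] := hP _ k0.
have [_ hlt' _ hmin _] := hP _ (ltn0Sn k).
by apply: hmin => //; exact: ltn_trans hlt'.
Qed.

Lemma best_approx_ln_height_le k : (0 < k)%N -> L k <= L k.+1.
Proof.
move=> k0; have hk := best_approx_height_ge _ k0.
have := best_approx_height_le _ k0 => hle.
by rewrite ler_ln ?posrE ?ltr0n ?ler_nat// (leq_trans k0)// (leq_trans hk).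
Qed.

Lemma best_approx_coprime_near : (0 < n)%N ->
  (\forall k \near \oo, coprimep (P k) (P k.+1)) ->
  (\forall k \near \oo, 0 < E k) ->
  exists C : R, \forall k \near \oo,
    E k <= n%:R * L k.+1 + n.-1%:R * L k + C.
Proof.
move=> n0 hcop hE; have [K K0 hK] := resultant_lower_bound R n theta n0.
exists (ln K); near=> k.
have k0 : (0 < k)%N by near: k; exact: nbhs_infty_gt.
have Ek : 0 < E k by near: k.
have ck : coprimep (P k) (P k.+1) by near: k.
have [[P0 sP] _ e0 _ _] := hP _ k0.
have [[P0' sP'] _ _ _ _] := hP _ (ltn0Sn k).
(* A nonzero integer constant has absolute value at least 1, which contradicts [0 < E k]. *)
have s1 : (1 < size (P k))%N.
  rewrite ltnNge; apply: contraTN Ek => /size1_polyC Pk.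
  rewrite -leNgt oppr_le0 ln_ge0// Pk /evalZ map_polyC hornerC /= -intr_norm.
  rewrite -[1]/(1%:~R) ler_int -gtz0_ge1 normr_gt0.
  by apply: contraNneq P0 => c0; rewrite Pk c0.
have := hK _ _ sP sP' s1 ck (best_approx_height_le _ k0)
  (best_approx_evalZ_le _ k0).
have H0 : 0 < (height (P k))%:R :> R by rewrite ltr0n height_gt0.
have H0' : 0 < (height (P k.+1))%:R :> R by rewrite ltr0n height_gt0.
move=> /ln_ge0; rewrite !lnM ?posrE ?mulr_gt0 ?exprn_gt0// !lnXn//.
rewrite -[ln _ *+ n]mulr_natl -[ln _ *+ n.-1]mulr_natl.
by rewrite /log_value /log_height; lra.
Unshelve. all: by end_near.
Qed.

(** Only finitely many polynomials beat an exponent above [w_exp], and the height of [P k], being at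
    least [k], eventually exceeds all of theirs. *)
Lemma best_approx_lt_w_exp (w : R) : (w_exp n theta < w%:E)%E ->
  \forall k \near \oo, E k <= w * L k.
Proof.
move=> ww; pose S := [set Q : {poly int} | [/\ Q != 0, (size Q <= n.+1)%N &
  `|evalZ Q theta| < (height Q)%:R `^ (- w)]].
have /finite_seqP[s Ss] : finite_set S.
  apply: contrapT => Sinf; move: ww; rewrite ltNge => /negP; apply.
  by apply: ereal_sup_ubound; exists w.
near=> k; have k0 : (0 < k)%N by near: k; exact: nbhs_infty_gt.
have sk : (\max_(Q <- s) height Q < k)%N by near: k; exact: nbhs_infty_gt.
have [[P0 sP] _ e0 _ _] := hP _ k0.
have : ~ S (P k).
  rewrite Ss /= => Pks; have : (height (P k) <= \max_(Q <- s) height Q)%N.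
    exact: leq_bigmax_seq.
  rewrite leqNgt => /negP; apply; apply: (leq_trans sk).
  exact: best_approx_height_ge.
move=> SPk; have : ~~ (`|evalZ (P k) theta| < (height (P k))%:R `^ (- w)).
  by apply/negP => lk; apply: SPk; split.
rewrite -leNgt -(@ler_ln _ (_ `^ _)) ?posrE ?powR_gt0 ?ltr0n ?height_gt0//.
by rewrite ln_powR /log_value /log_height; lra.
Unshelve. all: by end_near.
Qed.

(** The uniform exponent is applied with [X] equal to half the height of [P k.+1]: the polynomial
    obtained then has height strictly below that of [P k.+1], as the minimality of [P k]
    requires. *)
Lemma best_approx_gt_what_exp (c : R) : (c%:E < what_exp n theta)%E ->
  \forall k \near \oo, c * L k.+1 <= E k.
Proof.
move=> /ereal_sup_gt[_ [c' /= [M [_ hM]] <-]]; rewrite lte_fin => cc'.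
near=> k; have k0 : (0 < k)%N by near: k; exact: nbhs_infty_gt.
have [[P0 sP] hlt e0 hmin _] := hP _ k0.
have hk := best_approx_height_ge _ (ltn0Sn k).
have Mk : M * 2 < k%:R by near: k; exact: nbhs_infty_gtr.
have H0 : 0 < (height (P k.+1))%:R :> R by rewrite ltr0n (leq_trans _ hk).
have [|Q [Q0 sQ hQ /andP[_ eQ]]] := hM ((height (P k.+1))%:R / 2).
  rewrite ltr_pdivlMr//; apply: (lt_le_trans Mk).
  by rewrite ler_nat ltnW.
have : `|evalZ (P k) theta| < ((height (P k.+1))%:R / 2) `^ (- c').
  apply: le_lt_trans eQ; apply: hmin => //; rewrite -(ltr_nat R).
  by apply: (le_lt_trans hQ); rewrite ltr_pdivrMr// ltr_pMr// ltr1n.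
rewrite -(@ltr_ln _ _ (_ `^ _)) ?posrE ?powR_gt0 ?divr_gt0//.
rewrite ln_powR ln_div ?posrE//.
(* The gap between [c] and [c'] absorbs the term [c' * ln 2] caused by the halving. *)
have Lk : c' * ln 2 / (c' - c) <= L k.
  near: k; exact: best_approx_ln_height_near.
have := best_approx_ln_height_le _ k0 => Lk'.
have {Lk Lk'} := le_trans Lk Lk'; rewrite ler_pdivrMr ?subr_gt0//.
by rewrite /log_value /log_height; lra.
Unshelve. all: by end_near.
Qed.

Lemma best_approx_dependent l : exists C : R, forall k, (0 < k)%N ->
  ~ Qlin_indep (fun i : 'I_l => P (k + i)%N) ->
  exists j m, [/\ (k <= j)%N, (0 < m < l)%N &
    E j.+1 <= E j + \sum_(i < m) L (j.+1 + i)%N + C].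
Proof.
(* This constant serves every [m < l] at once. *)
exists (ln (l * l`!)%:R) => k k0 dep.
have [i ki|i ki|j [m [kj ml hj]]] := dependent_segment R theta P k l _ _ dep.
- exact/best_approx_height_le/(leq_trans k0).
- exact/best_approx_evalZ_le/(leq_trans k0).
have j0 := leq_trans k0 kj.
have [_ _ e0 _ _] := hP _ j0; have [_ _ e1 _ _] := hP _ (ltn0Sn j).
have H0 i : (0 < height (P (j.+1 + i)))%N.
  exact: leq_trans (best_approx_height_ge _ (ltn0Sn (j + i))).
(* For [m = 0] the bound would force [P j] to vanish at [theta]. *)
have m0 : (0 < m)%N.
  rewrite lt0n; apply: contraTneq hj => ->; rewrite mul0n mul0r.
  by rewrite -ltNge.
exists j, m; rewrite m0 ml; split=> //.
have p0 : (0 < m * m`!)%N by rewrite muln_gt0 m0 fact_gt0.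
have q0 : (0 < \prod_(i < m) height (P (j.+1 + i)))%N.
  by rewrite prodn_gt0.
have hlm : ln (m * m`!)%:R <= ln (l * l`!)%:R :> R.
  rewrite ler_ln ?posrE ?ltr0n//.
    by rewrite ler_nat leq_mul ?leq_fact// ltnW.
  by rewrite muln_gt0 fact_gt0 (leq_trans _ ml).
move: hj; rewrite natrM -(@ler_ln _ `|_|) ?posrE ?mulr_gt0 ?ltr0n//.
rewrite lnM ?posrE ?mulr_gt0 ?ltr0n// lnM ?posrE ?ltr0n//.
rewrite (ln_prod_natr _ _ (fun i => height (P (j.+1 + i)%N)))//.
by rewrite /log_value /log_height; lra.
Qed.

End BestApprox.

(** * Density, eventual properties and perturbation *)

Lemma ereal_lt_dense (R : realType) (x y : \bar R) :
  (x < y)%E -> exists2 r : R, (x < r%:E)%E & (r%:E < y)%E.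
Proof.
case: x y => [x| |] [y| |] //=.
- by rewrite lte_fin => xy; exists ((x + y) / 2); rewrite lte_fin; lra.
- by move=> _; exists (x + 1); rewrite ?ltry// lte_fin ltrDl.
- by move=> _; exists (y - 1); rewrite ?ltNyr// lte_fin; lra.
- by move=> _; exists 0; rewrite ?ltNyr ?ltry.
Qed.

Lemma lee_from_below (R : realType) (x y : \bar R) :
  (forall r : R, (r%:E < x)%E -> (r%:E <= y)%E) -> (x <= y)%E.
Proof.
move=> h; rewrite leNgt; apply/negP => /ereal_lt_dense[r yr /h].
by rewrite leNgt yr.
Qed.

Lemma near_nat_forall (Q : nat -> Prop) :
  (\forall k \near \oo, Q k) ->
  \forall k \near \oo, forall j, (k <= j)%N -> Q j.
Proof.
by move=> [N _ hN]; exists N => // k /= Nk j kj; apply: hN; exact: leq_trans kj.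
Qed.

(** The difference of the two sides is a polynomial in [e], negative at 0, hence negative for small
    positive [e] by continuity. This makes room for exponents that are reached only up to [e]. *)
Lemma perturb_geometric_sum (R : realType) l (t a c : R) :
  0 < a -> 0 < c -> \sum_(i < l) t ^+ i < a * c ->
  exists e, [/\ 0 < e, e < a, e < c &
    \sum_(i < l) (t + e) ^+ i < (a - e) * (c - e)].
Proof.
move=> a0 c0 hs.
pose q : {poly R} := \sum_(i < l) (t%:P + 'X) ^+ i - (a%:P - 'X) * (c%:P - 'X).
have qE e : q.[e] = \sum_(i < l) (t + e) ^+ i - (a - e) * (c - e).
  rewrite /q hornerD hornerN hornerM horner_sum !hornerE; congr (_ - _).
  by apply: eq_bigr => i _; rewrite !hornerE.
have q0 : q.[0] < 0.
  by rewrite qE !subr0; under eq_bigr do rewrite addr0; rewrite subr_lt0.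
have hq : q.[e] @[e --> 0^'+] --> q.[0].
  by apply: cvg_at_right_filter; exact: continuous_horner.
have [e [e0 ea ec qe]] : exists e, [/\ 0 < e, e < a, e < c & q.[e] < 0].
  near (0 : R)^'+ => e; exists e; split; near: e.
  - exact: nbhs_right_gt.
  - exact: nbhs_right_lt.
  - exact: nbhs_right_lt.
  - exact: (cvgr_lt _ hq).
by exists e; split=> //; rewrite -subr_lt0 -qE.
Unshelve. all: by end_near.
Qed.

(** * Comparison of the exponents and linear independence *)

Section Exponents.
Variables (R : realType) (n : nat) (theta : R) (P : nat -> {poly int}).
Hypothesis n_gt0 : (0 < n)%N.
Hypothesis theta_nalg : forall d, (d <= n)%N -> ~ algebraic_of_degree theta d.
Hypothesis hP : best_approx n theta P.
Hypothesis hcop : \forall k \near \oo, coprimep (P k) (P k.+1).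
Hypothesis hnu : ((2 * n%:R - 1)%:E < nu_inf theta P)%E.

Local Notation L := (log_height R P).
Local Notation E := (log_value R theta P).
Local Notation nu := (nu_inf theta P).
Local Notation w := (w_exp n theta).

Let n_ge1 : 1 <= n%:R :> R. Proof. by rewrite ler1n. Qed.

Lemma log_height_near (A : R) : \forall k \near \oo, A <= L k.
Proof. exact: best_approx_ln_height_near hP A. Qed.

Lemma log_value_gt_near (v : R) :
  (v%:E < nu)%E -> \forall k \near \oo, v * L k < E k.
Proof.
move=> /near_gt_limn_einf hv; near=> k.
have L0 : 0 < L k.
  by apply: (@lt_le_trans _ _ 1) => //; near: k; exact: log_height_near.
have : (v%:E < (- (ln `|evalZ (P k) theta| / ln (height (P k))%:R))%:E)%E.
  by near: k.
by rewrite lte_fin -mulNr ltr_pdivlMr.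
Unshelve. all: by end_near.
Qed.

(** As 2n - 1 >= 1, the hypothesis on [nu] makes [E k] exceed [L k], which tends to infinity. *)
Lemma log_value_near (A : R) : \forall k \near \oo, A <= E k.
Proof.
near=> k.
have hk : (2 * n%:R - 1) * L k < E k by near: k; exact: log_value_gt_near.
have L0 : 0 <= L k by near: k; exact: log_height_near.
have LA : A <= L k by near: k; exact: log_height_near.
by apply/ltW/(le_lt_trans LA)/(le_lt_trans _ hk); rewrite ler_peMl//;
  move: n_ge1; lra.
Unshelve. all: by end_near.
Qed.

Lemma log_value_le_near : exists C : R, \forall k \near \oo,
  E k <= n%:R * L k.+1 + (n%:R - 1) * L k + C.
Proof.
have [|C hC] := best_approx_coprime_near _ _ _ _ hP n_gt0 hcop.
  near=> k; apply: (@lt_le_trans _ _ 1) => //; near: k; exact: log_value_near.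
exists C; apply: filterS hC => k.
by rewrite -(natrB _ n_gt0) subn1.
Unshelve. all: by end_near.
Qed.

(** Otherwise (2n - 1 + e) L_(k+1) <= E_k <= n L_(k+1) + (n - 1) L_k + C <= (2n - 1) L_(k+1) + C,
    which fails for large k. *)
Lemma what_exp_le : (what_exp n theta <= (2 * n%:R - 1)%:E)%E.
Proof.
apply/lee_addgt0Pr => e e0; rewrite leNgt; apply/negP => hlt.
have [C hC] := log_value_le_near.
have hE := best_approx_gt_what_exp _ _ _ _ hP _ hlt.
near \oo => k.
have k0 : (0 < k)%N by near: k; exact: nbhs_infty_gt.
have h1 : E k <= n%:R * L k.+1 + (n%:R - 1) * L k + C by near: k.
have h2 : (2 * n%:R - 1 + e) * L k.+1 <= E k by near: k.
have h3 : L k <= L k.+1 by exact: best_approx_ln_height_le hP _ k0.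
have h4 : (C + 1) / e <= L k by near: k; exact: log_height_near.
have h5 : C + 1 <= e * L k.+1.
  by rewrite mulrC -ler_pdivrMr// (le_trans h4).
have h6 : (n%:R - 1) * L k <= (n%:R - 1) * L k.+1.
  by rewrite ler_wpM2l// subr_ge0.
by move: h1 h2 h5 h6; lra.
Unshelve. all: by end_near.
Qed.

Lemma what_exp_fin : exists c : R,
  [/\ what_exp n theta = c%:E, n%:R <= c & c <= 2 * n%:R - 1].
Proof.
have := what_exp_le; have := what_exp_ge R n theta n_gt0 theta_nalg.
case: (what_exp n theta) => [c| |] //.
by rewrite !lee_fin => h1 h2; exists c.
Qed.

Lemma nu_le_w_exp : (nu <= w)%E.
Proof.
apply: lee_from_below => v hv; rewrite leNgt; apply/negP => wv.
have h1 := log_value_gt_near _ hv.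
have h2 := best_approx_lt_w_exp _ _ _ _ hP _ wv.
near \oo => k.
have : v * L k < E k by near: k.
by rewrite ltNge => /negP; apply; near: k.
Unshelve. all: by end_near.
Qed.

(** Multiplying the resultant bound by some v < nu and using v L <= E at k and k+1 gives (v - n + 1)
    E_k <= n E_(k+1) + v C. Since v - n + 1 > n s, the surplus times E_k absorbs v C. *)
Lemma log_value_growth (s : R) : ((n%:R * s + n%:R - 1)%:E < nu)%E ->
  \forall k \near \oo, s * E k <= E k.+1.
Proof.
move=> hs; have [C hC] := log_value_le_near.
(* The second term of the maximum ensures [v > 0] whatever the sign of [s]. *)
have /ereal_lt_dense[v] :
    ((Num.max (n%:R * s + n%:R - 1) (2 * n%:R - 1))%:E < nu)%E.
  by rewrite maxEge; case: ifP.
rewrite lte_fin gt_max => /andP[vs v2n] vnu.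
have v0 : 0 < v by apply: le_lt_trans v2n; move: n_ge1; lra.
near=> k.
have h1 : E k <= n%:R * L k.+1 + (n%:R - 1) * L k + C by near: k.
have h2 : v * L k < E k by near: k; exact: log_value_gt_near.
have h3 : v * L k.+1 < E k.+1.
  near: k; move: (log_value_gt_near _ vnu) => [N _ hN]; exists N => // k /= Nk.
  exact/hN/leqW.
have h4 : v * C / (v - (n%:R * s + n%:R - 1)) <= E k.
  by near: k; exact: log_value_near.
move: h4; rewrite ler_pdivrMr ?subr_gt0// => h4.
have h5 : (n%:R - 1) * (v * L k) <= (n%:R - 1) * E k.
  by rewrite ler_wpM2l ?subr_ge0// ltW.
have h6 : v * E k <= v * (n%:R * L k.+1 + (n%:R - 1) * L k + C).
  by rewrite ler_pM2l.
have h7 : n%:R * (v * L k.+1) <= n%:R * E k.+1 by rewrite ler_wpM2l// ltW.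
rewrite -(ler_pM2l (lt_le_trans ltr01 n_ge1)).
by move: h4 h5 h6 h7; lra.
Unshelve. all: by end_near.
Qed.

Lemma sigma_inf_ge :
  ((nu - n%:R%:E + 1) / n%:R%:E <= sigma_inf theta P)%E.
Proof.
have n0 : (0 : R) < n%:R by exact: lt_le_trans n_ge1.
apply: lee_from_below => s hs; apply: limn_einf_ge_near.
have hs' : ((n%:R * s + n%:R - 1)%:E < nu)%E.
  move: hs hnu; rewrite inver gt_eqF//; case: nu => [v| |] //.
    rewrite -EFinB -EFinD -EFinM !lte_fin ltr_pdivlMr// => hs _.
    by move: hs; lra.
  by move=> _ _; rewrite ltry.
have hg := log_value_growth _ hs'.
near=> k.
have h1 : s * E k <= E k.+1 by near: k.
have E0 : 0 < E k.
  by apply: (@lt_le_trans _ _ 1) => //; near: k; exact: log_value_near.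
rewrite lee_fin; move: h1; rewrite -ler_pdivlMr//.
by rewrite /log_value invrN mulrNN.
Unshelve. all: by end_near.
Qed.

Lemma log_height_growth (x c t : R) :
  w = x%:E -> what_exp n theta = c%:E -> 0 < c -> 0 < x -> x / c < t ->
  \forall k \near \oo, L k.+1 <= t * L k.
Proof.
move=> wx wc c0 x0; rewrite ltr_pdivrMr// => xt.
have t0 : 0 < t by rewrite -(pmulr_lgt0 _ c0) (lt_trans x0).
(* [d] solves x + d = t (c - d), so that (c - d) L_(k+1) <= E_k <= (x + d) L_k is exactly the claim
   after division by c - d. *)
pose d := (t * c - x) / (1 + t).
have t1 : 0 < 1 + t by rewrite addr_gt0.
have d0 : 0 < d by rewrite divr_gt0// subr_gt0.
have dE : x + d = t * (c - d) by rewrite /d; field; rewrite gt_eqF.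
have dc : 0 < c - d by rewrite -(pmulr_rgt0 _ t0) -dE addr_gt0.
have h1 : (w < (x + d)%:E)%E by rewrite wx lte_fin ltrDl.
have h2 : ((c - d)%:E < what_exp n theta)%E by rewrite wc lte_fin gtrBl.
have {}h1 := best_approx_lt_w_exp _ _ _ _ hP _ h1.
have {}h2 := best_approx_gt_what_exp _ _ _ _ hP _ h2.
near=> k.
rewrite -(ler_pM2l dc) mulrA [_ * t]mulrC -dE; apply: (@le_trans _ _ (E k)).
  by near: k.
by near: k.
Unshelve. all: by end_near.
Qed.

Lemma w_exp_gt : ((2 * n%:R - 1)%:E < w)%E.
Proof. exact: lt_le_trans hnu nu_le_w_exp. Qed.

Lemma tau_sup_le : (tau_sup R P <= w / what_exp n theta)%E.
Proof.
have [c [cE nc c2]] := what_exp_fin; have := w_exp_gt; rewrite cE.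
have c0 : 0 < c by rewrite (lt_le_trans _ nc)// ltr0n.
case wE : w => [x| |] //; rewrite inver gt_eqF//; last first.
  by move=> _; rewrite gt0_mulye ?leey// lte_fin invr_gt0.
rewrite lte_fin => xn; have cx := le_lt_trans c2 xn.
have x0 : 0 < x by exact: lt_trans cx.
apply/lee_addgt0Pr => e e0; apply: limn_esup_le_near.
have xe : x / c < x / c + e by rewrite ltrDl.
have hg := log_height_growth _ _ _ wE cE c0 x0 xe.
near=> k.
have L0 : 0 < L k.
  by apply: (@lt_le_trans _ _ 1) => //; near: k; exact: log_height_near.
by rewrite -EFinM -EFinD lee_fin ler_pdivrMr//; near: k.
Unshelve. all: by end_near.
Qed.

Lemma Qlin_indep_near_of_sum (x v c : R) l :
  w = x%:E -> nu = v%:E -> what_exp n theta = c%:E ->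
  \sum_(i < l) (x / c) ^+ i < (v - 2 * n%:R + 1) / n%:R * c ->
  \forall k \near \oo, Qlin_indep (fun i : 'I_l.+1 => P (k + i)%N).
Proof.
move=> wE nuE cE; set a := _ / n%:R => hsum.
have n0 : (0 : R) < n%:R by exact: lt_le_trans n_ge1.
have [c' [c'E nc _]] := what_exp_fin.
have {c' c'E}nc : n%:R <= c by move: c'E; rewrite cE => -[->].
have c0 : 0 < c by exact: lt_le_trans nc.
have x0 : 0 < x.
  have := w_exp_gt; rewrite wE lte_fin => /(le_lt_trans _); apply.
  by move: n_ge1; lra.
have a0 : 0 < a.
  by rewrite divr_gt0//; move: hnu; rewrite nuE lte_fin; lra.
have [e [e0 ea ec he]] := perturb_geometric_sum _ _ _ _ _ a0 c0 hsum.
set t := x / c + e in he; set S := \sum_(_ < _) _ in he.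
have t0 : 0 <= t by rewrite addr_ge0 ?divr_ge0 ?ltW.
have hL : \forall k \near \oo, L k.+1 <= t * L k.
  by apply: (log_height_growth _ _ _ wE cE c0 x0); rewrite ltrDl.
have hE : \forall k \near \oo, (1 + (a - e)) * E k <= E k.+1.
  apply: log_value_growth; rewrite nuE lte_fin.
  (* This identity shows that 1 + a is the limiting growth rate of [E]; the rate 1 + a - e is
     therefore admissible. *)
  have -> : v = n%:R * (1 + a) + n%:R - 1 by rewrite /a; field; rewrite gt_eqF.
  by rewrite ltrD2r ltrD2r ltr_pM2l//; lra.
have hc : \forall k \near \oo, (c - e) * L k.+1 <= E k.
  by apply: (best_approx_gt_what_exp _ _ _ _ hP); rewrite cE lte_fin gtrBl.
have [C hC] := best_approx_dependent _ _ _ _ hP l.+1.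
pose D := (a - e) * (c - e) - S.
have D0 : 0 < D by rewrite subr_gt0.
near=> k.
have k0 : (0 < k)%N by near: k; exact: nbhs_infty_gt.
(* The estimates are needed at every [j >= k], since a relation among the polynomials from [P k] on
   is exploited at an index [j] not known in advance. *)
have hLk : forall j, (k <= j)%N -> L j.+1 <= t * L j.
  by near: k; exact: near_nat_forall.
have hEk : forall j, (k <= j)%N -> (1 + (a - e)) * E j <= E j.+1.
  by near: k; exact: near_nat_forall.
have hck : forall j, (k <= j)%N -> (c - e) * L j.+1 <= E j.
  by near: k; exact: near_nat_forall.
have hLC : forall j, (k <= j)%N -> (`|C| + 1) / D <= L j.
  by near: k; apply: near_nat_forall; exact: log_height_near.
apply: contrapT => /(hC _ k0)[j [m [kj /andP[m0 ml] hj]]].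
have LC := hLC _ (leqW kj).
have L0 : 0 <= L j.+1.
  apply: (le_trans _ LC); apply: divr_ge0; last exact: ltW.
  by rewrite addr_ge0.
have hLi i : L (j.+1 + i) <= t ^+ i * L j.+1.
  elim: i => [|i IH]; first by rewrite addn0 mul1r.
  rewrite addnS exprS -mulrA; apply: le_trans (hLk _ _) _.
    by rewrite addSn leqW// (leq_trans kj)// leq_addr.
  by rewrite ler_wpM2l.
have hs : \sum_(i < m) L (j.+1 + i) <= S * L j.+1.
  apply: (@le_trans _ _ ((\sum_(i < m) t ^+ i) * L j.+1)).
    by rewrite mulr_suml ler_sum.
  rewrite ler_wpM2r// /S -(subnKC (ml : (m <= l)%N)) big_split_ord /= lerDl.
  by rewrite sumr_ge0// => i _; exact: exprn_ge0.
have h1 := hEk _ kj.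
(* The relation gives E_(j+1) - E_j <= S L_(j+1) + C, while growth gives at least (a - e)(c - e)
   L_(j+1); the difference [D] times L_(j+1) exceeds C. *)
have h2 : (a - e) * ((c - e) * L j.+1) <= (a - e) * E j.
  by rewrite ler_wpM2l ?hck// subr_ge0 ltW.
move: LC; rewrite ler_pdivrMr// /D => LC.
have := ler_norm C.
by move: LC h1 h2 hs hj; lra.
Unshelve. all: by end_near.
Qed.

Lemma Qlin_indep_near l : (1 <= l)%N ->
  (l%:R%:E < ell_bound n nu w (what_exp n theta))%E ->
  \forall k \near \oo, Qlin_indep (fun i : 'I_l => P (k + i)%N).
Proof.
case: l => // -[_ _|l _].
  (* For a single polynomial, a relation would require some [m] with 0 < m < 1. *)
  have [C hC] := best_approx_dependent _ _ _ _ hP 1.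
  exists 1%N => // k /= k0; apply: contrapT => /(hC _ k0)[j [m []]].
  by case: m.
have [c [cE nc c2]] := what_exp_fin; have := w_exp_gt; have := nu_le_w_exp.
move: hnu; rewrite /ell_bound cE.
case wE : w => [x| |]; case nuE : nu => [v| |] //=; last 2 first.
(* An infinite [w] makes the bound equal to 2, which excludes [l.+2]. *)
- by move=> _ _ _; rewrite lte_fin ltr_nat.
- by move=> _ _ _; rewrite lte_fin ltr_nat.
rewrite !lte_fin lee_fin => nv vx xn.
have n0 : (0 : R) < n%:R by exact: lt_le_trans n_ge1.
have c0 : 0 < c by exact: lt_le_trans nc.
have cx : c < x by exact: le_lt_trans xn.
have xc : 1 < x / c by rewrite ltr_pdivlMr// mul1r.
rewrite -[l.+2%:R]natr1 ltrD2r ltr_pdivlMr ?ln_gt0// [_ * ln _]mulr_natl.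
set a0 := _ / n%:R => hlt.
apply: (Qlin_indep_near_of_sum _ _ _ _ wE nuE cE).
have a00 : 0 < a0 + 1.
  rewrite ltr_wpDl// divr_ge0 ?mulr_ge0 ?subr_ge0 ?ltW//.
  by move: nv; lra.
move: hlt; rewrite -lnXn ?ltr_ln ?posrE ?exprn_gt0 ?(lt_trans _ xc)//.
(* The geometric series is summed: with r = x/c, r^(l+1) - 1 is r - 1 times the sum, and [a0] is r -
   1 times the right side of the goal. *)
rewrite -ltrBlDr subrX1 => hlt; have xc0 : 0 < x / c - 1 by rewrite subr_gt0.
rewrite -(ltr_pM2l xc0); apply: (lt_le_trans hlt).
rewrite /a0 le_eqVlt; apply/orP; left; apply/eqP.
by field; rewrite !gt_eqF.
Qed.

(** For infinite [w] both sides are 2; otherwise this is [ln_ratio_ge] with m = n. *)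
Lemma ell_bound_what_exp_ge :
  (ell_bound n nu w n%:R%:E <= ell_bound n nu w (what_exp n theta))%E.
Proof.
have [c [cE nc c2]] := what_exp_fin; have := w_exp_gt; have := nu_le_w_exp.
move: hnu; rewrite /ell_bound cE.
case wE : w => [x| |]; case nuE : nu => [v| |] //=.
rewrite !lte_fin lee_fin => nv vx xn; rewrite lee_fin lerD2r.
have n0 : (0 : R) < n%:R by exact: lt_le_trans n_ge1.
have aE (y : R) : (v - 2 * n%:R + 1) * (x - y) / n%:R =
  (v - 2 * n%:R + 1) / n%:R * (x - y) by rewrite mulrAC.
rewrite !aE; apply: ln_ratio_ge => //; last exact: le_lt_trans xn.
by rewrite divr_ge0 ?(ltW n0)//; move: nv; lra.
Qed.

End Exponents.

Theorem theorem4p12 (R : realType) (n : nat) (theta : R)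
    (P : nat -> {poly int})
    (hn : (1 <= n)%N)
    (htheta : forall d : nat, (d <= n)%N -> ~ algebraic_of_degree theta d)
    (hP : best_approx n theta P)
    (hcop : \forall k \near \oo, coprimep (P k) (P k.+1))
    (hnu : ((2 * n%:R - 1)%:E < nu_inf theta P)%E) :
  [/\ ((nu_inf theta P - n%:R%:E + 1) / n%:R%:E <= sigma_inf theta P)%E,
      (tau_sup R P <= w_exp n theta / what_exp n theta)%E,
      (forall l : nat, (1 <= l)%N ->
        (l%:R%:E < ell_bound n (nu_inf theta P) (w_exp n theta)
                     (what_exp n theta))%E ->
        \forall k \near \oo, Qlin_indep (fun i : 'I_l => P (k + i)%N)) &
      (* replacing what_n by its lower bound n can only decrease ell_bound *)
      (ell_bound n (nu_inf theta P) (w_exp n theta) n%:R%:E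
         <= ell_bound n (nu_inf theta P) (w_exp n theta)
              (what_exp n theta))%E].
Proof.
split.
- exact: (sigma_inf_ge _ _ _ _ hn hP hcop hnu).
- exact: (tau_sup_le _ _ _ _ hn htheta hP hcop hnu).
- exact: (Qlin_indep_near _ _ _ _ hn htheta hP hcop hnu).
- exact: (ell_bound_what_exp_ge _ _ _ _ hn htheta hP hcop hnu).
Qed.
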